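(* Let $L$ be a (not necessarily distributive) lattice. Then the 4 free objects $F_{\mathrm{Lat}}^{\mathrm{VL}}[L]$, $F_{\mathrm{Lat}}^{\mathrm{VLA}}[L]$, $F_{\mathrm{Lat}}^{\mathrm{VLA}^1}[L]$, and $F_{\mathrm{Lat}}^{\mathrm{VLA}^{1+}}[L]$ all exist. There are inclusions $$F_{\mathrm{Lat}}^{\mathrm{VL}}[L]\subset F_{\mathrm{Lat}}^{\mathrm{VLA}}[L],\qquad F_{\mathrm{Lat}}^{\mathrm{VLA}}[L]\subset F_{\mathrm{Lat}}^{\mathrm{VLA}^1}[L],\qquad F_{\mathrm{Lat}}^{\mathrm{VLA}}[L]\subset F_{\mathrm{Lat}}^{\mathrm{VLA}^{1+}}[L],$$ in the sense that the canonical maps are injective, and the canonical unital vector lattice algebra homomorphism $F_{\mathrm{Lat}}^{\mathrm{VLA}^1}[L]\to F_{\mathrm{Lat}}^{\mathrm{VLA}^{1+}}[L]$ is surjective. The accompanying map $j:L\to F_{\mathrm{Lat}}^{\mathrm{VL}}[L]$ is injective if and only if $L$ is distributive.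
   Context: All vector spaces are over the real numbers. A lattice is a non-empty partially ordered set in which any two elements have a supremum and an infimum (equivalently, a non-empty set with two binary operations that are associative, idempotent, commutative and satisfy the absorption laws); distributivity is not assumed. An algebra is an associative real algebra, not necessarily unital or commutative. A vector lattice algebra is a vector lattice that is also an algebra such that the product of two positive elements is positive. The identity element of a unital vector lattice algebra need not be positive (and $1=0$ is not excluded). A vector lattice algebra homomorphism is a linear map between vector lattice algebras that is a lattice homomorphism and an algebra homomorphism; it is called unital if it maps the identity element to the identity element. Categories: $\mathrm{Lat}$: lattices with lattice homomorphisms (maps preserving binary suprema and infima); $\mathrm{VL}$: vector lattices with vector lattice homomorphisms; $\mathrm{VLA}$: vector lattice algebras with vector lattice algebra homomorphisms; $\mathrm{VLA}^1$: unital vector lattice algebras with unital vector lattice algebra homomorphisms; $\mathrm{VLA}^{1+}$: unital vector lattice algebras with a positive identity element, with unital vector lattice algebra homomorphisms. In the chain $\mathrm{Lat}\supset\mathrm{VL}\supset\mathrm{VLA}\supset\mathrm{VLA}^1\supset\mathrm{VLA}^{1+}$, each category is regarded as a subcategory of those to the left of it (by forgetting structure). Free objects: let $\mathrm{Cat}_2$ be a subcategory of $\mathrm{Cat}_1$ and let $O_1$ be an object of $\mathrm{Cat}_1$. A free object over $O_1$ of $\mathrm{Cat}_2$ is a pair $(j,F_{\mathrm{Cat}_1}^{\mathrm{Cat}_2}[O_1])$, where $F_{\mathrm{Cat}_1}^{\mathrm{Cat}_2}[O_1]$ is an object of $\mathrm{Cat}_2$ and $j:O_1\to F_{\mathrm{Cat}_1}^{\mathrm{Cat}_2}[O_1]$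 is a morphism of $\mathrm{Cat}_1$, such that for every object $O_2$ of $\mathrm{Cat}_2$ and every morphism $\varphi:O_1\to O_2$ of $\mathrm{Cat}_1$ there is a unique morphism $\overline{\varphi}:F_{\mathrm{Cat}_1}^{\mathrm{Cat}_2}[O_1]\to O_2$ of $\mathrm{Cat}_2$ with $\varphi=\overline{\varphi}\circ j$. Canonical maps: if $\mathrm{Cat}_1\supset\mathrm{Cat}_2\supset\mathrm{Cat}_3$ and both free objects over $O_1$ exist, with accompanying maps $j_2:O_1\to F_{\mathrm{Cat}_1}^{\mathrm{Cat}_2}[O_1]$ and $j_3:O_1\to F_{\mathrm{Cat}_1}^{\mathrm{Cat}_3}[O_1]$, the canonical map $F_{\mathrm{Cat}_1}^{\mathrm{Cat}_2}[O_1]\to F_{\mathrm{Cat}_1}^{\mathrm{Cat}_3}[O_1]$ is the unique morphism $\psi$ of $\mathrm{Cat}_2$ with $j_3=\psi\circ j_2$. *)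

(* Defs.v *)
From HB Require Import structures.
From mathcomp Require Import all_boot all_order all_algebra.
From mathcomp Require Import reals.

Set Implicit Arguments.
Unset Strict Implicit.
Unset Printing Implicit Defensive.

Import Order.TTheory GRing.Theory Num.Theory.

Local Open Scope ring_scope.

(* Conventions.
   - [latticeType d] and the structures below live on choiceTypes; under
     classical logic with choice every type is one, so this does not restrict
     the class of lattices. The display [d] is phantom.
   - The product of an algebra is the library's [semigroupType] product, written
     [(x * y)%g], because the rings and algebras of ssralg are unital. Despite
     the scope name, no inverses are involved. The identity element of a unital
     algebra is the [monoidType] element [1%g]; since no [1 <> 0] axiom is
     present, the zero algebra is allowed. *)

#[short(type="porderedLmodType")]
HB.structure Definition POrderedLmodule (R : realType) :=
  { V of Num.POrderedZmodule V & GRing.Lmodule R V }.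

(* A structure extending both [latticeType] and [zmodType] cannot be declared
   below the already existing [realDomainType], so the infimum and supremum are
   carried by this mixin, exactly as in the library's
   [POrder_isMeetSemilattice] and [POrder_isJoinSemilattice], and the
   [latticeType] is recovered in [vl_lattice]. *)
HB.mixin Record POrderedLmodule_isVectorLattice (R : realType) V
    of POrderedLmodule R V := {
  vl_inf : V -> V -> V ;
  vl_sup : V -> V -> V ;
  vl_le_inf : forall x y z : V, (x <= vl_inf y z) = (x <= y) && (x <= z) ;
  vl_sup_le : forall x y z : V, (vl_sup x y <= z) = (x <= z) && (y <= z) ;
  vl_leD2r : forall x y z : V, x <= y -> x + z <= y + z ;
  vl_scale_ge0 : forall (a : R) (x : V), 0 <= a -> 0 <= x -> 0 <= a *: x
}.

#[short(type="vectorLatticeType")]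
HB.structure Definition VectorLattice (R : realType) :=
  { V of POrderedLmodule R V & POrderedLmodule_isVectorLattice R V }.

Definition vl_lattice (R : realType) (V : vectorLatticeType R) :
    latticeType ring_display :=
  HB.pack_for (latticeType ring_display) (VectorLattice.sort V)
    (@Order.POrder_isMeetSemilattice.Build ring_display (VectorLattice.sort V)
       (@vl_inf R V) (@vl_le_inf R V))
    (@Order.POrder_isJoinSemilattice.Build ring_display (VectorLattice.sort V)
       (@vl_sup R V) (@vl_sup_le R V)).

HB.mixin Record VectorLattice_isAlgebra (R : realType) A
    of VectorLattice R A & Semigroup A := {
  vla_mulDl : forall x y z : A, ((x + y) * z)%g = (x * z)%g + (y * z)%g ;
  vla_mulDr : forall x y z : A, (x * (y + z))%g = (x * y)%g + (x * z)%g ;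
  vla_scaleAl : forall (a : R) (x y : A), (a *: x * y)%g = a *: (x * y)%g ;
  vla_scaleAr : forall (a : R) (x y : A), (x * (a *: y))%g = a *: (x * y)%g ;
  vla_mul_ge0 : forall x y : A, 0 <= x -> 0 <= y -> 0 <= (x * y)%g
}.

#[short(type="vlaType")]
HB.structure Definition VLA (R : realType) :=
  { A of VectorLattice R A & Semigroup A & VectorLattice_isAlgebra R A }.

#[short(type="unitalVlaType")]
HB.structure Definition UnitalVLA (R : realType) :=
  { A of VLA R A & Monoid A }.

HB.mixin Record UnitalVLA_hasPositiveOne (R : realType) A
    of UnitalVLA R A := {
  vla_one_ge0 : (0 : A) <= 1%g
}.

#[short(type="posUnitalVlaType")]
HB.structure Definition PosUnitalVLA (R : realType) :=
  { A of UnitalVLA R A & UnitalVLA_hasPositiveOne R A }.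

Definition lat_hom d d' (L : latticeType d) (M : latticeType d') (f : L -> M) :=
  Order.meet_morphism f /\ Order.join_morphism f.

Definition vl_hom (R : realType) (V W : vectorLatticeType R) (f : V -> W) :=
  linear f /\ @lat_hom _ _ (vl_lattice V) (vl_lattice W) f.

Definition vla_hom (R : realType) (A B : vlaType R) (f : A -> B) :=
  vl_hom f /\ {morph f : x y / (x * y)%g}.

Definition vla1_hom (R : realType) (A B : unitalVlaType R) (f : A -> B) :=
  vla_hom f /\ f 1%g = 1%g.

(* The category with objects [C], underlying lattices [U] and morphisms [hom]
   is regarded as a subcategory of the category of lattices. *)
Definition is_free_over_lattice d (L : latticeType d)
    (C : Type) (U : C -> latticeType ring_display)
    (hom : forall A B : C, (U A -> U B) -> Prop)
    (F : C) (j : L -> U F) : Prop :=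
  lat_hom j /\
  forall (A : C) (phi : L -> U A), lat_hom phi ->
    exists! psi : U F -> U A, hom F A psi /\ phi = psi \o j.

Definition is_free_VL (R : realType) d (L : latticeType d)
    (F : vectorLatticeType R) (j : L -> F) : Prop :=
  @is_free_over_lattice d L (vectorLatticeType R) (fun A => vl_lattice A)
    (fun A B f => @vl_hom R A B f) F j.

Definition is_free_VLA (R : realType) d (L : latticeType d)
    (F : vlaType R) (j : L -> F) : Prop :=
  @is_free_over_lattice d L (vlaType R) (fun A => vl_lattice A)
    (fun A B f => @vla_hom R A B f) F j.

Definition is_free_VLA1 (R : realType) d (L : latticeType d)
    (F : unitalVlaType R) (j : L -> F) : Prop :=
  @is_free_over_lattice d L (unitalVlaType R) (fun A => vl_lattice A)
    (fun A B f => @vla1_hom R A B f) F j.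

Definition is_free_VLA1p (R : realType) d (L : latticeType d)
    (F : posUnitalVlaType R) (j : L -> F) : Prop :=
  @is_free_over_lattice d L (posUnitalVlaType R) (fun A => vl_lattice A)
    (fun A B f => @vla1_hom R A B f) F j.

Definition is_canonical_map (L F G : Type) (hom : (F -> G) -> Prop)
    (j : L -> F) (k : L -> G) (psi : F -> G) : Prop :=
  unique (fun f : F -> G => hom f /\ k = f \o j) psi.

Definition surjective (S T : Type) (f : S -> T) : Prop :=
  forall y, exists x, f x = y.

Definition distributive_lattice d (L : latticeType d) : Prop :=
  left_distributive (@Order.meet d L) (@Order.join d L).

(* Main.v *)
Require Import Defs.
From HB Require Import structures.
From mathcomp Require Import all_boot all_order all_algebra.
From mathcomp Require Import boolp classical_sets reals.

Set Implicit Arguments.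
Unset Strict Implicit.
Unset Printing Implicit Defensive.

Import Order.TTheory GRing.Theory Num.Theory.

Local Open Scope ring_scope.
Local Open Scope quotient_scope.

(** Existence.  All four free objects are built from one language of terms over
    the generators [L], with symbols for the vector lattice operations, a
    product and an identity element.  Two terms are identified when they take
    the same value in every object of the category under every lattice
    homomorphism from [L] into it, and the quotient is ordered by comparing
    values in the same way.  The axioms of the category are equations, or
    implications between inequalities, so they pass from all the objects to
    the quotient; this is why no normal form and no calculus of identities is
    needed.  Evaluation of terms is the morphism required by the universal
    property, and it is the only one because the generators generate
    ([free_model_ind]).  The quantification over the proper class of all
    objects takes place inside a proposition, so the quotient itself is small.

    Inclusions.  A vector lattice becomes a vector lattice algebra with the
    product zero.  Hence the canonical map from the free vector lattice [F] to
    the free vector lattice algebra can be followed by a map back to [F] that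
    restores the generators, and it is injective
    ([free_VL_VLA_injective]).  Likewise a vector lattice algebra [A] embeds in
    [A * R], ordered coordinatewise, which has the positive identity element
    [(0, 1)]; the canonical maps from the free vector lattice algebra to the
    two unital free objects can be followed by a map into its unitization that
    extends this embedding ([free_VLA_unital_injective]).  The free unital
    object with positive identity is generated by [L] and its identity
    element, and all of these lie in the image of the canonical map from the
    free unital object ([free_VLA1_VLA1p_surjective]).

    Distributivity.  Vector lattices are distributive ([vl_distributive]), so
    [L] is distributive if it embeds in one.  Conversely, in a distributive
    lattice two distinct points are separated by a prime filter, whose
    indicator function is a lattice homomorphism to the real numbers; it
    factors through the free vector lattice, which therefore also separates
    the two points ([free_VL_injectiveP]). *)

(** * Homomorphisms *)

Section LatHom.
Variables (R : realType) (d : Order.disp_t) (L : latticeType d).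
Variables (V W : vectorLatticeType R).

Lemma lat_homP (f : L -> vl_lattice V) :
  lat_hom f <->
  {morph f : x y / Order.meet x y >-> vl_inf x y} /\
  {morph f : x y / Order.join x y >-> vl_sup x y}.
Proof. by []. Qed.

Lemma vl_homP (f : V -> W) :
  vl_hom f <->
  [/\ linear f, {morph f : x y / vl_inf x y} & {morph f : x y / vl_sup x y}].
Proof. by split=> [[? []]|[]]; do ?split. Qed.

Lemma vl_hom_linear (f : V -> W) : vl_hom f ->
  [/\ f 0 = 0, {morph f : x / - x}, {morph f : x y / x + y}
    & forall a, {morph f : x / a *: x}].
Proof.
move=> [lin _].
have fD : {morph f : x y / x + y}.
  by move=> x y; have := lin 1 x y; rewrite !scale1r.
have f0 : f 0 = 0 by apply: (addrI (f 0)); rewrite -fD !addr0.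
have fZ a : {morph f : x / a *: x}.
  by move=> x; have := lin a x 0; rewrite f0 !addr0.
by split=> // x; rewrite -scaleN1r fZ scaleN1r.
Qed.
End LatHom.


Section HomComposition.
Variable R : realType.

Lemma vl_hom_comp (V W X : vectorLatticeType R) (f : V -> W) (g : W -> X) :
  vl_hom f -> vl_hom g -> vl_hom (g \o f).
Proof.
move=> /vl_homP[flin finf fsup] /vl_homP[glin ginf gsup].
by apply/vl_homP; split=> [a x y|x y|x y] /=;
  rewrite ?flin ?glin ?finf ?ginf ?fsup ?gsup.
Qed.

Lemma vla_hom_comp (A B D : vlaType R) (f : A -> B) (g : B -> D) :
  vla_hom f -> vla_hom g -> vla_hom (g \o f).
Proof.
move=> [hf fM] [hg gM]; split; first exact: vl_hom_comp hf hg.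
by move=> x y; rewrite /= fM gM.
Qed.

Lemma vla1_hom_comp (A B D : unitalVlaType R) (f : A -> B) (g : B -> D) :
  vla1_hom f -> vla1_hom g -> vla1_hom (g \o f).
Proof.
move=> [hf f1] [hg g1]; split; first exact: vla_hom_comp hf hg.
by rewrite /= f1.
Qed.

Lemma lat_hom_comp d (L : latticeType d) (V W : vectorLatticeType R)
    (j : L -> vl_lattice V) (f : V -> W) :
  lat_hom j -> vl_hom f -> lat_hom (f \o j : L -> vl_lattice W).
Proof.
move=> [jm jj] [_ [fm fj]].
by split=> x y; rewrite /= ?jm ?jj ?fm ?fj.
Qed.
End HomComposition.

(** * The term model of a class of vector lattices with a product *)

Section FreeModel.
Variables (R : realType) (d : Order.disp_t) (L : latticeType d).

(** The names of the elements that [L] generates.  One language serves all four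
    categories: where a category has no product or no identity element, the
    corresponding symbols are interpreted by zero. *)
Inductive term : Type :=
| Gen of L
| Zero
| Opp of term
| Add of term & term
| Scale of R & term
| Inf of term & term
| Sup of term & term
| One
| Mul of term & term.

HB.instance Definition _ := gen_eqMixin term.
HB.instance Definition _ := gen_choiceMixin term.

(* The class of models: an object [c] has the underlying vector lattice [U c],
   with a product and a distinguished element subject to no laws. *)
Variables (C : Type) (U : C -> vectorLatticeType R).
Variables (one : forall c, U c) (mul : forall c, U c -> U c -> U c).

Fixpoint eval (c : C) (phi : L -> U c) (t : term) : U c :=
  match t with
  | Gen x => phi x
  | Zero => 0
  | Opp s => - eval phi s
  | Add s1 s2 => eval phi s1 + eval phi s2
  | Scale a s => a *: eval phi s
  | Inf s1 s2 => vl_inf (eval phi s1) (eval phi s2)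
  | Sup s1 s2 => vl_sup (eval phi s1) (eval phi s2)
  | One => one c
  | Mul s1 s2 => mul (eval phi s1) (eval phi s2)
  end.

Definition valid (P : forall c, U c -> U c -> Prop) (s t : term) : Prop :=
  forall (c : C) (phi : L -> vl_lattice (U c)), lat_hom phi ->
    P c (eval phi s) (eval phi t).

Definition same_value (s t : term) : bool := `[< valid (fun c => eq) s t >].

Lemma same_value_equiv : equiv_class_of same_value.
Proof.
split=> [t|s t|s t u].
- by apply/asboolP.
- by apply/asboolP/asboolP => st c phi hphi; rewrite (st c phi hphi).
- move=> /asboolP st /asboolP tu; apply/asboolP => c phi hphi.
  by rewrite (st c phi hphi) (tu c phi hphi).
Qed.

Canonical same_value_rel := EquivRelPack same_value_equiv.

Definition free_model : Type := {eq_quot same_value_rel}.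

HB.instance Definition _ := Choice.on free_model.
HB.instance Definition _ := EqQuotient.on free_model.

Definition value (c : C) (phi : L -> U c) (q : free_model) : U c :=
  eval phi (repr q).

Lemma value_pi c (phi : L -> vl_lattice (U c)) t :
  lat_hom phi -> value phi (\pi_free_model t) = eval phi t.
Proof.
move=> hphi.
have /eqmodP/asboolP H : repr (\pi_free_model t) = t %[mod free_model].
  by rewrite reprK.
exact: H.
Qed.

(** The classes of terms are determined by their values; with [valueE] this
    reduces every law of the quotient to the same law in the models. *)
Lemma value_ext (p q : free_model) :
  (forall c (phi : L -> vl_lattice (U c)), lat_hom phi ->
     value phi p = value phi q) -> p = q.
Proof.
move=> H; rewrite -[p]reprK -[q]reprK; apply/eqmodP/asboolP.
exact: H.
Qed.

Definition free_gen (x : L) : free_model := \pi_free_model (Gen x).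
Definition free_zero : free_model := \pi_free_model Zero.
Definition free_opp (p : free_model) : free_model :=
  \pi_free_model (Opp (repr p)).
Definition free_add (p q : free_model) : free_model :=
  \pi_free_model (Add (repr p) (repr q)).
Definition free_scale (a : R) (p : free_model) : free_model :=
  \pi_free_model (Scale a (repr p)).
Definition free_inf (p q : free_model) : free_model :=
  \pi_free_model (Inf (repr p) (repr q)).
Definition free_sup (p q : free_model) : free_model :=
  \pi_free_model (Sup (repr p) (repr q)).
Definition free_one : free_model := \pi_free_model One.
Definition free_mul (p q : free_model) : free_model :=
  \pi_free_model (Mul (repr p) (repr q)).
Definition free_le (p q : free_model) : bool :=
  `[< valid (fun c => <=%R) (repr p) (repr q) >].

Section Value.
Variables (c : C) (phi : L -> vl_lattice (U c)).
Hypothesis hphi : lat_hom phi.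

Lemma value_gen x : value phi (free_gen x) = phi x.
Proof. exact: value_pi. Qed.
Lemma value_zero : value phi free_zero = 0.
Proof. exact: value_pi. Qed.
Lemma value_opp p : value phi (free_opp p) = - value phi p.
Proof. exact: value_pi. Qed.
Lemma value_add p q : value phi (free_add p q) = value phi p + value phi q.
Proof. exact: value_pi. Qed.
Lemma value_scale a p : value phi (free_scale a p) = a *: value phi p.
Proof. exact: value_pi. Qed.
Lemma value_inf p q :
  value phi (free_inf p q) = vl_inf (value phi p) (value phi q).
Proof. exact: value_pi. Qed.
Lemma value_sup p q :
  value phi (free_sup p q) = vl_sup (value phi p) (value phi q).
Proof. exact: value_pi. Qed.
Lemma value_one : value phi free_one = one c.
Proof. exact: value_pi. Qed.
Lemma value_mul p q :
  value phi (free_mul p q) = mul (value phi p) (value phi q).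
Proof. exact: value_pi. Qed.
End Value.

Definition valueE := (value_zero, value_opp, value_add, value_scale, value_inf,
  value_sup, value_one, value_mul, value_gen).

Lemma free_leP (p q : free_model) :
  reflect (forall c (phi : L -> vl_lattice (U c)), lat_hom phi ->
             value phi p <= value phi q) (free_le p q).
Proof. exact: asboolP. Qed.

Fact free_addA : associative free_add.
Proof.
by move=> p q r; apply: value_ext => c phi h; rewrite !valueE // addrA.
Qed.
Fact free_addC : commutative free_add.
Proof.
by move=> p q; apply: value_ext => c phi h; rewrite !valueE // addrC.
Qed.
Fact free_add0 : left_id free_zero free_add.
Proof.
by move=> p; apply: value_ext => c phi h; rewrite !valueE // add0r.
Qed.
Fact free_addN : left_inverse free_zero free_opp free_add.
Proof.
by move=> p; apply: value_ext => c phi h; rewrite !valueE // addNr.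
Qed.

HB.instance Definition _ := GRing.isZmodule.Build free_model
  free_addA free_addC free_add0 free_addN.

Fact free_scaleA a b p : free_scale a (free_scale b p) = free_scale (a * b) p.
Proof. by apply: value_ext => c phi h; rewrite !valueE // scalerA. Qed.
Fact free_scale1 : left_id 1 free_scale.
Proof.
by move=> p; apply: value_ext => c phi h; rewrite !valueE // scale1r.
Qed.
Fact free_scaleDr : right_distributive free_scale +%R.
Proof.
by move=> a p q; apply: value_ext => c phi h; rewrite !valueE // scalerDr.
Qed.
Fact free_scaleDl p : {morph free_scale^~ p : a b / a + b}.
Proof.
by move=> a b; apply: value_ext => c phi h; rewrite !valueE // scalerDl.
Qed.

HB.instance Definition _ := GRing.Zmodule_isLmodule.Build R free_model
  free_scaleA free_scale1 free_scaleDr free_scaleDl.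

Fact free_le_refl : reflexive free_le.
Proof. by move=> p; apply/free_leP. Qed.
Fact free_le_anti : antisymmetric free_le.
Proof.
move=> p q /andP[/free_leP pq /free_leP qp]; apply: value_ext => c phi h.
by apply/le_anti; rewrite pq // qp.
Qed.
Fact free_le_trans : transitive free_le.
Proof.
move=> q p r /free_leP pq /free_leP qr; apply/free_leP => c phi h.
exact: le_trans (pq c phi h) (qr c phi h).
Qed.

HB.instance Definition _ := Order.Le_isPOrder.Build ring_display free_model
  free_le_refl free_le_anti free_le_trans.

Fact free_le_inf (p q r : free_model) :
  (p <= free_inf q r) = (p <= q) && (p <= r).
Proof.
apply/free_leP/andP=> [H|[/free_leP pq /free_leP pr] c phi h].
  by split; apply/free_leP => c phi h; have := H c phi h;
     rewrite valueE // vl_le_inf => /andP[].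
by rewrite valueE // vl_le_inf pq // pr.
Qed.
Fact free_sup_le (p q r : free_model) :
  (free_sup p q <= r) = (p <= r) && (q <= r).
Proof.
apply/free_leP/andP=> [H|[/free_leP pr /free_leP qr] c phi h].
  by split; apply/free_leP => c phi h; have := H c phi h;
     rewrite valueE // vl_sup_le => /andP[].
by rewrite valueE // vl_sup_le pr // qr.
Qed.
Fact free_leD2r (p q r : free_model) : p <= q -> p + r <= q + r.
Proof.
move=> /free_leP pq; apply/free_leP => c phi h.
by rewrite !valueE //; apply/vl_leD2r/pq.
Qed.
Fact free_scale_ge0 (a : R) (p : free_model) : 0 <= a -> 0 <= p -> 0 <= a *: p.
Proof.
move=> a0 /free_leP p0; apply/free_leP => c phi h.
have := p0 c phi h; rewrite !valueE // => ?; exact: vl_scale_ge0.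
Qed.

HB.instance Definition _ := POrderedLmodule_isVectorLattice.Build R free_model
  free_le_inf free_sup_le free_leD2r free_scale_ge0.

Lemma free_gen_lat_hom : lat_hom (free_gen : L -> vl_lattice free_model).
Proof.
by split=> x y; apply: value_ext => c phi h; rewrite !valueE //;
  case: (h) => [phiI phiS]; rewrite ?phiI ?phiS.
Qed.

Lemma value_vl_hom c (phi : L -> vl_lattice (U c)) :
  lat_hom phi -> vl_hom (value phi : free_model -> U c).
Proof.
move=> h; apply/vl_homP; split=> [a x y|x y|x y]; first by rewrite !valueE.
- exact: value_inf.
- exact: value_sup.
Qed.

(** The quotient is generated by [L]: uniqueness of the induced morphisms and
    surjectivity of the last canonical map both rest on this. *)
Lemma free_model_ind (P : free_model -> Prop) :
  (forall x, P (free_gen x)) -> P 0 -> (forall p, P p -> P (- p)) ->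
  (forall p q, P p -> P q -> P (p + q)) -> (forall a p, P p -> P (a *: p)) ->
  (forall p q, P p -> P q -> P (vl_inf p q)) ->
  (forall p q, P p -> P q -> P (vl_sup p q)) ->
  P free_one -> (forall p q, P p -> P q -> P (free_mul p q)) ->
  forall p, P p.
Proof.
move=> Pgen P0 PN PD PZ PI PS P1 PM p; rewrite -[p]reprK.
(* A compound class is a value-equal combination of the classes of its parts. *)
have transport (s : term) (q : free_model) : P q ->
    (forall c (phi : L -> vl_lattice (U c)), lat_hom phi ->
      eval phi s = value phi q) -> P (\pi_free_model s).
  move=> Pq sq; suff -> : \pi_free_model s = q by [].
  by apply: value_ext => c phi h; rewrite value_pi // sq.
elim: (repr p)
  => [x||s IHs|s IHs t IHt|a s IHs|s IHs t IHt|s IHs t IHt||s IHs t IHt].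
- exact: Pgen.
- exact: P0.
- by apply: (transport _ _ (PN _ IHs)) => c phi h; rewrite valueE // value_pi.
- by apply: (transport _ _ (PD _ _ IHs IHt)) => c phi h;
    rewrite valueE // !value_pi.
- by apply: (transport _ _ (PZ a _ IHs)) => c phi h; rewrite valueE // value_pi.
- by apply: (transport _ _ (PI _ _ IHs IHt)) => c phi h;
    rewrite valueE // !value_pi.
- by apply: (transport _ _ (PS _ _ IHs IHt)) => c phi h;
    rewrite valueE // !value_pi.
- exact: P1.
- by apply: (transport _ _ (PM _ _ IHs IHt)) => c phi h;
    rewrite valueE // !value_pi.
Qed.

(** A morphism is determined by its values on the generators.  Since [one] and
    [mul] are arbitrary, this covers morphisms that preserve only part of the
    structure, once the remaining symbols are interpreted by zero. *)
Lemma value_unique c (phi : L -> vl_lattice (U c)) (psi : free_model -> U c) :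
  lat_hom phi -> vl_hom psi -> psi free_one = one c ->
  {morph psi : p q / free_mul p q >-> mul p q} ->
  phi = psi \o free_gen -> value phi = psi.
Proof.
move=> hphi hpsi psi1 psiM phiE.
have [psi0 psiN psiD psiZ] := vl_hom_linear hpsi.
have /vl_homP[_ psiI psiS] := hpsi.
apply/funext => p; elim/free_model_ind: p
  => [x||p IHp|p q IHp IHq|a p IHp|p q IHp IHq|p q IHp IHq||p q IHp IHq].
- by rewrite valueE // phiE.
- by rewrite psi0 valueE.
- by rewrite psiN valueE // IHp.
- by rewrite psiD valueE // IHp IHq.
- by rewrite psiZ valueE // IHp.
- by rewrite psiI valueE // IHp IHq.
- by rewrite psiS valueE // IHp IHq.
- by rewrite psi1 valueE.
- by rewrite psiM valueE // IHp IHq.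
Qed.

End FreeModel.

(** * Algebra structures on the term model *)

Section FreeAlgebra.
Variables (R : realType) (d : Order.disp_t) (L : latticeType d).
Variables (C : Type) (A : C -> vlaType R) (one : forall c, A c).

Definition free_algebra : Type :=
  free_model L one (fun (c : C) (x y : A c) => (x * y)%g).

HB.instance Definition _ := VectorLattice.on free_algebra.

Let prod (p q : free_algebra) : free_algebra := free_mul p q.

Fact free_algebra_mulA : associative prod.
Proof.
by move=> p q r; apply: value_ext => c phi h; rewrite !valueE // mulgA.
Qed.

HB.instance Definition _ := isSemigroup.Build free_algebra free_algebra_mulA.

Fact free_algebra_mulDl (p q r : free_algebra) :
  ((p + q) * r)%g = (p * r)%g + (q * r)%g.
Proof. by apply: value_ext => c phi h; rewrite !valueE // vla_mulDl. Qed.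
Fact free_algebra_mulDr (p q r : free_algebra) :
  (p * (q + r))%g = (p * q)%g + (p * r)%g.
Proof. by apply: value_ext => c phi h; rewrite !valueE // vla_mulDr. Qed.
Fact free_algebra_scaleAl (a : R) (p q : free_algebra) :
  (a *: p * q)%g = a *: (p * q)%g.
Proof. by apply: value_ext => c phi h; rewrite !valueE // vla_scaleAl. Qed.
Fact free_algebra_scaleAr (a : R) (p q : free_algebra) :
  (p * (a *: q))%g = a *: (p * q)%g.
Proof. by apply: value_ext => c phi h; rewrite !valueE // vla_scaleAr. Qed.
Fact free_algebra_mul_ge0 (p q : free_algebra) :
  0 <= p -> 0 <= q -> 0 <= (p * q)%g.
Proof.
move=> /free_leP p0 /free_leP q0; apply/free_leP => c phi h.
have := p0 c phi h; have := q0 c phi h; rewrite !valueE // => ? ?.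
exact: vla_mul_ge0.
Qed.

HB.instance Definition _ := VectorLattice_isAlgebra.Build R free_algebra
  free_algebra_mulDl free_algebra_mulDr free_algebra_scaleAl
  free_algebra_scaleAr free_algebra_mul_ge0.

Lemma value_vla_hom c (phi : L -> vl_lattice (A c)) :
  lat_hom phi ->
  vla_hom (@value R d L C (fun c => A c) one
             (fun c (x y : A c) => (x * y)%g) c phi
           : free_algebra -> A c).
Proof.
move=> h; split; first exact: (@value_vl_hom R d L C A).
by move=> p q; exact: (@value_mul R d L C A one).
Qed.

End FreeAlgebra.

Section FreeUnitalAlgebra.
Variables (R : realType) (d : Order.disp_t) (L : latticeType d).
Variables (C : Type) (A : C -> unitalVlaType R).

Definition free_unital_algebra : Type :=
  @free_algebra R d L C (fun c => A c) (fun c => 1%g).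

HB.instance Definition _ := VLA.on free_unital_algebra.

Let one : free_unital_algebra := free_one _ _ _.

Fact free_unital_mul1 :
  left_id one (fun x y : free_unital_algebra => (x * y)%g).
Proof. by move=> p; apply: value_ext => c phi h; rewrite !valueE // mul1g. Qed.
Fact free_unital_mulr1 :
  right_id one (fun x y : free_unital_algebra => (x * y)%g).
Proof. by move=> p; apply: value_ext => c phi h; rewrite !valueE // mulg1. Qed.

HB.instance Definition _ := Semigroup_isMonoid.Build free_unital_algebra
  free_unital_mul1 free_unital_mulr1.

Lemma value_vla1_hom c (phi : L -> vl_lattice (A c)) :
  lat_hom phi ->
  vla1_hom (@value R d L C (fun c => A c) (fun c => 1%g)
              (fun c (x y : A c) => (x * y)%g) c phi
            : free_unital_algebra -> A c).
Proof.
by move=> h; split; [exact: value_vla_hom|exact: (@value_one R d L C A)].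
Qed.

End FreeUnitalAlgebra.

Section FreePosUnitalAlgebra.
Variables (R : realType) (d : Order.disp_t) (L : latticeType d).
Variables (C : Type) (A : C -> posUnitalVlaType R).

Definition free_pos_unital_algebra : Type :=
  @free_unital_algebra R d L C (fun c => A c).

HB.instance Definition _ := UnitalVLA.on free_pos_unital_algebra.

Fact free_pos_unital_one_ge0 : (0 : free_pos_unital_algebra) <= 1%g.
Proof.
by apply/free_leP => c phi h; rewrite !valueE // vla_one_ge0.
Qed.

HB.instance Definition _ :=
  UnitalVLA_hasPositiveOne.Build R free_pos_unital_algebra
    free_pos_unital_one_ge0.

End FreePosUnitalAlgebra.

(** * Existence of the free objects *)

Section Existence.
Variables (R : realType) (d : Order.disp_t) (L : latticeType d).

(** With both extra symbols interpreted by zero, terms that contain them denote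
    elements that the vector lattice operations already produce. *)
Definition free_vector_lattice : Type :=
  @free_model R d L (vectorLatticeType R) id (fun=> 0) (fun _ _ _ => 0).
HB.instance Definition _ := VectorLattice.on free_vector_lattice.

(** A vector lattice homomorphism preserves the product and the identity symbol
    automatically, because it preserves zero. *)
Lemma free_vector_lattice_free :
  @is_free_VL R d L free_vector_lattice (@free_gen _ _ _ _ _ _ _).
Proof.
split=> [|V phi hphi]; first exact: free_gen_lat_hom.
pose val : free_vector_lattice -> V :=
  @value R d L _ id (fun=> 0) (fun _ _ _ => 0) V phi.
exists val; split.
  split; last by apply/funext => x; rewrite /val /= value_gen.
  exact: (@value_vl_hom R d L _ id).
move=> psi [hpsi phiE]; have [psi0 _ _ _] := vl_hom_linear hpsi.
apply: (@value_unique R d L _ id) => //.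
  rewrite -[RHS]psi0; congr psi.
  by apply: value_ext => c f h; rewrite !valueE.
move=> p q; rewrite -[RHS]psi0; congr psi.
by apply: value_ext => c f h; rewrite !valueE.
Qed.

Lemma free_algebra_free :
  @is_free_VLA R d L (@free_algebra R d L (vlaType R) id (fun=> 0))
    (@free_gen _ _ _ _ _ _ _).
Proof.
split=> [|A phi hphi]; first exact: free_gen_lat_hom.
exists (@value R d L (vlaType R) (fun A => A) (fun=> 0)
   (fun A (x y : A) => (x * y)%g) A phi); split.
  split; last by apply/funext => x; rewrite /= value_gen.
  exact: (@value_vla_hom R d L _ id).
move=> psi [[hpsi psiM] phiE]; have [psi0 _ _ _] := vl_hom_linear hpsi.
apply: (@value_unique R d L (vlaType R) (fun A => A)) => //.
rewrite -[RHS]psi0; congr psi.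
by apply: value_ext => c f h; rewrite !valueE.
Qed.

Lemma free_unital_algebra_free :
  @is_free_VLA1 R d L (@free_unital_algebra R d L (unitalVlaType R) id)
    (@free_gen _ _ _ _ _ _ _).
Proof.
split=> [|A phi hphi]; first exact: free_gen_lat_hom.
exists (@value R d L (unitalVlaType R) (fun A => A) (fun=> 1%g)
   (fun A (x y : A) => (x * y)%g) A phi); split.
  split; last by apply/funext => x; rewrite /= value_gen.
  exact: (@value_vla1_hom R d L _ id).
move=> psi [[[hpsi psiM] psi1] phiE].
by apply: (@value_unique R d L (unitalVlaType R) (fun A => A)).
Qed.

Lemma free_pos_unital_algebra_free :
  @is_free_VLA1p R d L (@free_pos_unital_algebra R d L (posUnitalVlaType R) id)
    (@free_gen _ _ _ _ _ _ _).
Proof.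
split=> [|A phi hphi]; first exact: free_gen_lat_hom.
exists (@value R d L (posUnitalVlaType R) (fun A => A) (fun=> 1%g)
   (fun A (x y : A) => (x * y)%g) A phi); split.
  split; last by apply/funext => x; rewrite /= value_gen.
  exact: (@value_vla1_hom R d L (posUnitalVlaType R) (fun A => A)).
move=> psi [[[hpsi psiM] psi1] phiE].
by apply: (@value_unique R d L (posUnitalVlaType R) (fun A => A)).
Qed.

End Existence.

(** * The zero product and the unitization *)

Section ZeroProduct.
Variables (R : realType) (V : vectorLatticeType R).

(** An alias of [V], so that the zero product does not compete with other
    products on the same carrier. *)
Definition zero_product : Type := V.

HB.instance Definition _ := VectorLattice.on zero_product.

Let mul (x y : zero_product) : zero_product := 0.

HB.instance Definition _ :=
  @isSemigroup.Build zero_product mul (fun _ _ _ => erefl).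

HB.instance Definition _ := @VectorLattice_isAlgebra.Build R zero_product
  (fun _ _ _ => esym (addr0 (0 : V))) (fun _ _ _ => esym (addr0 (0 : V)))
  (fun a _ _ => esym (scaler0 V a)) (fun a _ _ => esym (scaler0 V a))
  (fun _ _ _ _ => lexx (0 : V)).

End ZeroProduct.

Section Unitization.
Variables (R : realType) (A : vlaType R).

(** The coordinatewise order makes the identity element [(0, 1)] positive even
    when [A] already has an identity element that is not. *)
Definition unitization : Type := (A * R^o)%type.

HB.instance Definition _ := GRing.Lmodule.on unitization.

Implicit Types (x y z : unitization).

Let le x y : bool := (x.1 <= y.1) && ((x.2 : R) <= y.2).

Fact unitization_le_refl : reflexive le.
Proof. by move=> x; rewrite /le !lexx. Qed.
Fact unitization_le_anti : antisymmetric le.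
Proof.
move=> [x a] [y b]; rewrite /le /= => /andP[/andP[xy ab] /andP[yx ba]].
by congr pair; apply/le_anti; rewrite ?xy ?ab.
Qed.
Fact unitization_le_trans : transitive le.
Proof.
move=> y x z /andP[xy1 xy2] /andP[yz1 yz2].
by apply/andP; split; [exact: le_trans xy1 yz1|exact: le_trans xy2 yz2].
Qed.

HB.instance Definition _ := Order.Le_isPOrder.Build ring_display unitization
  unitization_le_refl unitization_le_anti unitization_le_trans.

Let inf x y : unitization := (vl_inf x.1 y.1, Num.min (x.2 : R) y.2).
Let sup x y : unitization := (vl_sup x.1 y.1, Num.max (x.2 : R) y.2).

Lemma unitization_leE x y : (x <= y) = (x.1 <= y.1) && ((x.2 : R) <= y.2).
Proof. by []. Qed.

Fact unitization_le_inf x y z : (x <= inf y z) = (x <= y) && (x <= z).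
Proof. by rewrite !unitization_leE /= vl_le_inf le_min andbACA. Qed.
Fact unitization_sup_le x y z : (sup x y <= z) = (x <= z) && (y <= z).
Proof. by rewrite !unitization_leE /= vl_sup_le ge_max andbACA. Qed.
Fact unitization_leD2r x y z : x <= y -> x + z <= y + z.
Proof.
by rewrite !unitization_leE /= => /andP[xy ab]; rewrite vl_leD2r // lerD2r.
Qed.
Fact unitization_scale_ge0 (a : R) x : 0 <= a -> 0 <= x -> 0 <= a *: x.
Proof.
rewrite !unitization_leE /= => a0 /andP[x0 b0].
by rewrite vl_scale_ge0 // mulr_ge0.
Qed.

HB.instance Definition _ := POrderedLmodule_isVectorLattice.Build R unitization
  unitization_le_inf unitization_sup_le unitization_leD2r unitization_scale_ge0.

(* The product for which [(x, a)] behaves as the formal sum [x + a 1]. *)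
Let mul x y : unitization :=
  ((x.1 * y.1)%g + ((y.2 : R) *: x.1 + (x.2 : R) *: y.1), (x.2 : R) * y.2).
Let one : unitization := (0, 1).

Lemma vla_mul0l (x : A) : (0 * x)%g = 0.
Proof. by have := vla_scaleAl 0 x x; rewrite !scale0r. Qed.
Lemma vla_mul0r (x : A) : (x * 0)%g = 0.
Proof. by have := vla_scaleAr 0 x x; rewrite !scale0r. Qed.

Fact unitization_mulA : associative mul.
Proof.
move=> [x a] [y b] [z c]; rewrite /mul /=; congr pair; last by rewrite mulrA.
rewrite !vla_mulDl !vla_mulDr !vla_scaleAl !vla_scaleAr !scalerDr !scalerA.
(* Both sides are now sums of the same seven terms; the last step matches the
   order in which they occur. *)
rewrite mulgA [c * a]mulrC [c * b]mulrC.
by rewrite (AC ((1*2)*(1*(1*2))) ((1*(3*5))*((2*(4*6))*7))).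
Qed.
Fact unitization_mul1 : left_id one mul.
Proof.
by move=> [x a]; rewrite /mul /= vla_mul0l scaler0 scale1r !add0r mul1r.
Qed.
Fact unitization_mulr1 : right_id one mul.
Proof.
by move=> [x a]; rewrite /mul /= vla_mul0r scaler0 scale1r add0r addr0 mulr1.
Qed.

HB.instance Definition _ := isMonoid.Build unitization
  unitization_mulA unitization_mul1 unitization_mulr1.

Lemma unitization_mulE x y : (x * y)%g =
  ((x.1 * y.1)%g + ((y.2 : R) *: x.1 + (x.2 : R) *: y.1), (x.2 : R) * y.2)
  :> unitization.
Proof. by []. Qed.

Fact unitization_mulDl x y z : ((x + y) * z)%g = (x * z)%g + (y * z)%g.
Proof.
rewrite !unitization_mulE; congr pair; rewrite /= ?mulrDl //.
by rewrite vla_mulDl scalerDr scalerDl (AC (2*(2*2)) ((1*(3*5))*(2*(4*6)))).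
Qed.
Fact unitization_mulDr x y z : (x * (y + z))%g = (x * y)%g + (x * z)%g.
Proof.
rewrite !unitization_mulE; congr pair; rewrite /= ?mulrDr //.
by rewrite vla_mulDr scalerDr scalerDl (AC (2*(2*2)) ((1*(3*5))*(2*(4*6)))).
Qed.
Fact unitization_scaleAl (a : R) x y : (a *: x * y)%g = a *: (x * y)%g.
Proof.
rewrite !unitization_mulE; congr pair; last exact/esym/mulrA.
by rewrite /= vla_scaleAl !scalerDr !scalerA [a * _]mulrC.
Qed.
Fact unitization_scaleAr (a : R) x y : (x * (a *: y))%g = a *: (x * y)%g.
Proof.
rewrite !unitization_mulE; congr pair; last exact: mulrCA.
by rewrite /= vla_scaleAr !scalerDr !scalerA [_ * a]mulrC.
Qed.
Fact unitization_mul_ge0 x y : 0 <= x -> 0 <= y -> 0 <= (x * y)%g.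
Proof.
rewrite unitization_mulE !unitization_leE /= => /andP[x0 a0] /andP[y0 b0].
have leD (u v : A) : 0 <= u -> 0 <= v -> 0 <= u + v.
  by move=> u0 v0; apply: le_trans v0 _; rewrite -[leLHS]add0r vl_leD2r.
by rewrite mulr_ge0 // !leD // ?vla_mul_ge0 ?vl_scale_ge0.
Qed.

HB.instance Definition _ := VectorLattice_isAlgebra.Build R unitization
  unitization_mulDl unitization_mulDr unitization_scaleAl unitization_scaleAr
  unitization_mul_ge0.

Fact unitization_one_ge0 : (0 : unitization) <= 1%g.
Proof. by rewrite unitization_leE /= lexx ler01. Qed.

HB.instance Definition _ :=
  UnitalVLA_hasPositiveOne.Build R unitization unitization_one_ge0.

Definition unitization_in (x : A) : unitization := (x, 0).

Lemma unitization_in_inj : injective unitization_in.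
Proof. by move=> x y []. Qed.

Lemma unitization_in_hom : vla_hom unitization_in.
Proof.
split; last first.
  by move=> x y; rewrite unitization_mulE /= !scale0r !addr0 mulr0.
apply/vl_homP; split=> [a x y|x y|x y].
- by congr pair; rewrite /= scaler0 addr0.
- by congr pair; rewrite /= minxx.
- by congr pair; rewrite /= maxxx.
Qed.

End Unitization.

(** * Distributivity and separation by prime filters *)

Section Scalars.
Variable R : realType.

(** The real numbers as a vector lattice; the alias keeps this order apart from
    the existing structures on [R^o]. *)
Definition scalars : Type := R^o.

HB.instance Definition _ := GRing.Lmodule.on scalars.
HB.instance Definition _ := Order.Le_isPOrder.Build ring_display scalars
  (@lexx _ R) (@le_anti _ R) (@le_trans _ R).

Fact scalars_le_inf (x y z : scalars) :
  (x <= (Num.min (y : R) z : scalars)) = (x <= y) && (x <= z).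
Proof. exact: (@le_min _ R). Qed.
Fact scalars_sup_le (x y z : scalars) :
  ((Num.max (x : R) y : scalars) <= z) = (x <= z) && (y <= z).
Proof. exact: (@ge_max _ R). Qed.
Fact scalars_leD2r (x y z : scalars) : x <= y -> x + z <= y + z.
Proof. by move=> xy; exact: (etrans (@lerD2r R z x y) xy). Qed.
Fact scalars_scale_ge0 (a : R) (x : scalars) : 0 <= a -> 0 <= x -> 0 <= a *: x.
Proof. exact: mulr_ge0. Qed.

HB.instance Definition _ := POrderedLmodule_isVectorLattice.Build R scalars
  scalars_le_inf scalars_sup_le scalars_leD2r scalars_scale_ge0.

End Scalars.

Section Distributive.
Variables (R : realType) (V : vectorLatticeType R).
Implicit Types x y z u : V.

Lemma vl_inf_lel x y : vl_inf x y <= x.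
Proof. by have := lexx (vl_inf x y); rewrite vl_le_inf => /andP[]. Qed.
Lemma vl_inf_ler x y : vl_inf x y <= y.
Proof. by have := lexx (vl_inf x y); rewrite vl_le_inf => /andP[]. Qed.
Lemma vl_sup_gel x y : x <= vl_sup x y.
Proof. by have := lexx (vl_sup x y); rewrite vl_sup_le => /andP[]. Qed.
Lemma vl_sup_ger x y : y <= vl_sup x y.
Proof. by have := lexx (vl_sup x y); rewrite vl_sup_le => /andP[]. Qed.

Lemma vl_lerD2r z x y : (x + z <= y + z) = (x <= y).
Proof.
apply/idP/idP => [/(@vl_leD2r R V _ _ (- z))|]; last exact: vl_leD2r.
by rewrite !addrK.
Qed.
Lemma vl_lerD2l z x y : (z + x <= z + y) = (x <= y).
Proof. by rewrite ![z + _]addrC vl_lerD2r. Qed.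
Lemma vl_lerBlDr x y z : (x - y <= z) = (x <= z + y).
Proof. by rewrite -(vl_lerD2r y (x - y)) subrK. Qed.
Lemma vl_lerBrDr x y z : (x <= y - z) = (x + z <= y).
Proof. by rewrite -(vl_lerD2r z x (y - z)) subrK. Qed.

(** Translations and negation carry infima to suprema and back; distributivity
    follows from this link between the two. *)
Lemma vl_infDsup x y : vl_inf x y + vl_sup x y = x + y.
Proof.
apply/le_anti/andP; split.
  rewrite addrC -vl_lerBrDr vl_sup_le !vl_lerBrDr vl_lerD2l vl_inf_ler.
  by rewrite [leRHS]addrC vl_lerD2l vl_inf_lel.
rewrite -vl_lerBlDr vl_le_inf !vl_lerBlDr vl_lerD2l vl_sup_ger.
by rewrite addrC vl_lerD2l vl_sup_gel.
Qed.

(** By [vl_infDsup], a bound on [vl_inf a z] bounds [a] itself by an expression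
    that depends on [a] only through [vl_sup a z].  Replacing this supremum by
    the larger one of [x], [y] and [z] gives a common bound for [x] and [y],
    hence for their supremum, and [vl_infDsup] turns it back. *)
Lemma vl_distributive : distributive_lattice (vl_lattice V).
Proof.
move=> x y z; rewrite -[Order.meet (Order.join x y) z]/(vl_inf (vl_sup x y) z).
rewrite -[RHS]/(vl_sup (vl_inf x z) (vl_inf y z)).
apply/le_anti/andP; split; last first.
  rewrite vl_sup_le !vl_le_inf !vl_inf_ler !andbT.
  by rewrite (le_trans (vl_inf_lel _ _) (vl_sup_gel _ _))
             (le_trans (vl_inf_lel _ _) (vl_sup_ger _ _)).
set u := vl_sup (vl_inf x z) (vl_inf y z).
set s := vl_sup (vl_sup x y) z.
have bound a : vl_inf a z <= u -> a <= vl_sup x y -> a <= u + s - z.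
  move=> au axy; rewrite vl_lerBrDr -vl_infDsup.
  apply: (@le_trans _ _ (u + vl_sup a z)); first by rewrite vl_lerD2r.
  rewrite vl_lerD2l vl_sup_le vl_sup_ger andbT.
  exact: le_trans axy (vl_sup_gel _ _).
have : vl_sup x y <= u + s - z.
  by rewrite vl_sup_le !bound ?vl_sup_gel ?vl_sup_ger.
by rewrite vl_lerBrDr -vl_infDsup vl_lerD2r.
Qed.

End Distributive.

Section PrimeFilter.
Local Open Scope classical_set_scope.
Local Open Scope order_scope.
Variables (d : Order.disp_t) (L : latticeType d).
Implicit Types (F : set L) (x y z : L).

Definition is_filter F : Prop :=
  (forall x y, F x -> x <= y -> F y) /\
  (forall x y, F x -> F y -> F (x `&` y)).

(** Zorn's lemma yields a filter that is maximal among those containing [a] and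
    not [b].  Such a filter is prime: if [x] and [y] are outside it, then
    maximality puts [f `&` x] and [g `&` y] below [b] for some members [f] and
    [g], and distributivity puts [(f `&` g) `&` (x `|` y)] below [b]. *)
Lemma prime_filter_separation a b : distributive_lattice L -> ~~ (a <= b) ->
  exists F, [/\ is_filter F, F a, ~ F b &
    forall x y, F (x `|` y) -> F x \/ F y].
Proof.
move=> distr nab.
(* Containing [a] is imposed only on non-empty filters, because the union of the
   empty chain has to qualify. *)
pose avoiding F := [/\ is_filter F, ~ F b & forall x, F x -> F a].
have [|F [[[Fup Fmeet] Fb FA] Fmax]] := @Zorn_bigcup L avoiding.
  move=> G Gav Gtot; split.
  - split=> [x y [X GX Xx] xy|x y [X GX Xx] [Y GY Yy]].
      by exists X => //; have [[up _] _ _] := Gav _ GX; exact: up Xx xy.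
    have [XY|YX] := Gtot X Y GX GY.
      exists Y => //; have [[_ meY] _ _] := Gav _ GY.
      by apply: meY => //; exact: XY.
    exists X => //; have [[_ meX] _ _] := Gav _ GX.
    by apply: meX => //; exact: YX.
  - by move=> [X GX Xb]; have [_ /(_ Xb)] := Gav _ GX.
  - by move=> x [X GX Xx]; exists X => //; have [_ _ /(_ x Xx)] := Gav _ GX.
have Fa : F a.
  apply: contrapT => nFa; apply: (Fmax [set x | a <= x]).
    split; first by move=> x /FA.
    by move=> /(_ a (lexx a)).
  split=> /=.
  - split=> [x y ax xy|x y ax ay]; first exact: le_trans ax xy.
    by rewrite /= lexI ax.
  - exact/negP.
  - by [].
(* Otherwise the filter generated by [F] and [x] would contradict maximality. *)
have grow x : ~ F x -> exists2 f, F f & f `&` x <= b.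
  move=> nFx; apply: contrapT => nf.
  apply: (Fmax [set z | exists2 f, F f & f `&` x <= z]).
    split=> [z Fz|/(_ x)]; first by exists z => //; exact: leIl.
    by move=> H; apply: nFx; apply: H; exists a => //; exact: leIr.
  split=> [||z _]; [split| |].
  - by move=> y z [f Ff fy] yz; exists f => //; exact: le_trans fy yz.
  - move=> y z [f Ff fy] [g Fg gz]; exists (f `&` g); first exact: Fmeet.
    rewrite lexI; apply/andP; split.
      by apply: le_trans fy; rewrite leI2 // leIl.
    by apply: le_trans gz; rewrite leI2 // leIr.
  - exact: nf.
  - by exists a => //; exact: leIl.
exists F; split=> // x y Fxy; apply: contrapT => /not_orP[nFx nFy].
have [f Ff fx] := grow x nFx; have [g Fg gy] := grow y nFy.
apply: Fb; apply: (Fup ((x `|` y) `&` (f `&` g))).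
  exact: Fmeet (Fmeet _ _ _ _).
rewrite distr leUx; apply/andP; split.
  by apply: le_trans fx; rewrite meetC leI2 // leIl.
by apply: le_trans gy; rewrite meetC leI2 // leIr.
Qed.

End PrimeFilter.

Section Separation.
Variables (R : realType) (d : Order.disp_t) (L : latticeType d).

(** The indicator function of a prime filter is a lattice homomorphism: it
    preserves infima because the set is a filter, and suprema because it is
    prime. *)
Lemma distributive_separation (x y : L) : distributive_lattice L -> x <> y ->
  exists phi : L -> vl_lattice (scalars R), lat_hom phi /\ phi x <> phi y.
Proof.
have separate (a b : L) : distributive_lattice L -> ~~ (a <= b)%O ->
    exists phi : L -> vl_lattice (scalars R), lat_hom phi /\ phi a <> phi b.
  move=> distr nab.
  have [F [[Fup Fmeet] Fa Fb Fprime]] := prime_filter_separation distr nab.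
  pose phi (z : L) : scalars R := if `[< F z >] then (1 : R) else (0 : R).
  exists phi; split; last first.
    rewrite /phi asboolT // asboolF //; apply/eqP; exact: (@oner_neq0 R).
  apply/lat_homP; split=> z w; rewrite /phi.
    have -> : `[< F (z `&` w)%O >] = `[< F z >] && `[< F w >].
      apply/asboolP/andP => [Fzw|[/asboolP Fz /asboolP Fw]]; last exact: Fmeet.
      by split; apply/asboolP; apply: Fup Fzw _; [exact: leIl|exact: leIr].
    rewrite /vl_inf /=; case: ifP => [/andP[-> ->]|].
      by rewrite minxx.
    case: asboolP; case: asboolP => //= _ _ _;
      rewrite ?minxx ?(min_idPr ler01) ?(min_idPl ler01) //.
  have -> : `[< F (z `|` w)%O >] = `[< F z >] || `[< F w >].
    apply/asboolP/orP => [/Fprime[]Fz|[]/asboolP Fz]; [left|right| |].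
    - exact/asboolP.
    - exact/asboolP.
    - by apply: Fup Fz _; exact: leUl.
    - by apply: Fup Fz _; exact: leUr.
  rewrite /vl_sup /=.
  case: asboolP; case: asboolP => //= _ _;
    rewrite ?maxxx ?(max_idPr ler01) ?(max_idPl ler01) //.
move=> distr xy; have [le_xy|nxy] := boolP (x <= y)%O; last exact: separate.
have nyx : ~~ (y <= x)%O.
  by apply/negP => yx; apply: xy; apply/le_anti; rewrite le_xy.
by have [phi [hphi /nesym]] := separate y x distr nyx; exists phi.
Qed.

End Separation.

(** * The canonical maps *)

Section CanonicalMaps.
Variables (R : realType) (d : Order.disp_t) (L : latticeType d).

Lemma free_hom_ext (C : Type) (U : C -> latticeType ring_display)
    (hom : forall A B : C, (U A -> U B) -> Prop) (F : C) (j : L -> U F)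
    (A : C) (f g : U F -> U A) :
  is_free_over_lattice hom j -> lat_hom (f \o j) ->
  hom F A f -> hom F A g -> f \o j = g \o j -> f = g.
Proof.
move=> [_ jfree] fj hf hg fg; have [h [_ huniq]] := jfree A (f \o j) fj.
by rewrite -(huniq f (conj hf erefl)) (huniq g (conj hg fg)).
Qed.

Lemma free_VL_ext (F A : vectorLatticeType R) (j : L -> F) (f g : F -> A) :
  is_free_VL j -> @lat_hom _ _ L (vl_lattice A) (f \o j) ->
  vl_hom f -> vl_hom g -> f \o j = g \o j -> f = g.
Proof. exact: free_hom_ext. Qed.

Lemma free_VLA_ext (F A : vlaType R) (j : L -> F) (f g : F -> A) :
  is_free_VLA j -> @lat_hom _ _ L (vl_lattice A) (f \o j) ->
  vla_hom f -> vla_hom g -> f \o j = g \o j -> f = g.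
Proof. exact: free_hom_ext. Qed.

Lemma free_VLA1p_ext (F A : posUnitalVlaType R) (j : L -> F) (f g : F -> A) :
  is_free_VLA1p j -> @lat_hom _ _ L (vl_lattice A) (f \o j) ->
  vla1_hom f -> vla1_hom g -> f \o j = g \o j -> f = g.
Proof. exact: free_hom_ext. Qed.

(** The map back is given by the universal property of [G], applied to [F] with
    the product zero. *)
Lemma free_VL_VLA_injective (F : vectorLatticeType R) (j : L -> F)
    (G : vlaType R) (k : L -> G) (psi : F -> G) :
  is_free_VL j -> is_free_VLA k -> vl_hom psi -> k = psi \o j -> injective psi.
Proof.
move=> jfree [_ kfree] hpsi kE; have [jhom _] := jfree.
have [theta [[[htheta _] jE] _]] := kfree (zero_product F) j jhom.
apply: (@inj_compr _ _ _ theta).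
suff -> : theta \o psi = id by [].
apply: (@free_VL_ext F F j _ id jfree) => //.
- by rewrite -compA -kE -jE.
- exact: vl_hom_comp hpsi htheta.
- by rewrite -compA -kE -jE.
Qed.

(** The map [theta] comes from the universal property of the unital free object
    [G]; as a hypothesis, it allows the lemma to serve both with and without
    positivity of the identity element. *)
Lemma free_VLA_unital_injective (F : vlaType R) (j : L -> F)
    (G : unitalVlaType R) (k : L -> G) (psi : F -> G) :
  is_free_VLA j -> vla_hom psi -> k = psi \o j ->
  (exists theta : G -> unitization F,
    vla_hom theta /\ theta \o k = @unitization_in R F \o j) ->
  injective psi.
Proof.
move=> jfree hpsi kE [theta [htheta tE]]; have [jhom _] := jfree.
apply: (@inj_compr _ _ _ theta).
suff -> : theta \o psi = @unitization_in R F by exact: unitization_in_inj.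
have tpsi_j : (theta \o psi) \o j = @unitization_in R F \o j.
  by rewrite -compA -kE.
apply: (@free_VLA_ext F (unitization F) j _ _ jfree).
- rewrite tpsi_j; exact: lat_hom_comp jhom (unitization_in_hom F).1.
- exact: vla_hom_comp hpsi htheta.
- exact: unitization_in_hom.
- exact: tpsi_j.
Qed.

(** Every free object is a retract of the term model: the composite of the two
    comparison maps fixes the generators.  Hence its elements are named by
    terms, whatever its construction. *)
Lemma free_VLA1p_generated (F : posUnitalVlaType R) (k : L -> F)
    (y : F) : is_free_VLA1p k ->
  exists p : @free_pos_unital_algebra R d L (posUnitalVlaType R) id,
    @value R d L (posUnitalVlaType R) (fun A => A) (fun=> 1%g)
      (fun A (x y : A) => (x * y)%g) F k p = y.
Proof.
move=> kfree; have [khom kuniv] := kfree.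
have [gen_hom _] := free_pos_unital_algebra_free R L.
have [g [[hg genE] _]] := kuniv _ _ gen_hom.
exists (g y); set val := value _.
suff /(congr1 (@^~ y)) : val \o g = id by [].
have valg_k : (val \o g) \o k = k.
  by rewrite -compA -genE; apply/funext => x; rewrite /val /= value_gen.
apply: (@free_VLA1p_ext F F k _ id kfree) => //.
- by rewrite valg_k.
- apply: vla1_hom_comp hg _.
  exact: (@value_vla1_hom R d L (posUnitalVlaType R) (fun A => A)).
Qed.

Lemma free_VLA1_VLA1p_surjective (F : unitalVlaType R) (j : L -> F)
    (G : posUnitalVlaType R) (k : L -> G) (psi : F -> G) :
  is_free_VLA1p k -> vla1_hom psi -> k = psi \o j -> surjective psi.
Proof.
move=> kfree [[hpsi psiM] psi1] kE y; have [khom _] := kfree.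
have [p <-] := free_VLA1p_generated y kfree.
have [psi0 psiN psiD psiZ] := vl_hom_linear hpsi.
have /vl_homP[_ psiI psiS] := hpsi.
elim/free_model_ind: p
  => [x||p [x IHp]|p q [x IHp] [z IHq]|a p [x IHp]|p q [x IHp] [z IHq]
     |p q [x IHp] [z IHq]||p q [x IHp] [z IHq]].
- by exists (j x); rewrite valueE // kE.
- by exists 0; rewrite psi0 valueE.
- by exists (- x); rewrite psiN IHp valueE.
- by exists (x + z); rewrite psiD IHp IHq valueE.
- by exists (a *: x); rewrite psiZ IHp valueE.
- by exists (vl_inf x z); rewrite psiI IHp IHq valueE.
- by exists (vl_sup x z); rewrite psiS IHp IHq valueE.
- by exists 1%g; rewrite psi1 valueE.
- by exists (x * z)%g; rewrite psiM IHp IHq valueE.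
Qed.

Lemma free_VL_injectiveP (F : vectorLatticeType R) (j : L -> F) :
  is_free_VL j -> injective j <-> distributive_lattice L.
Proof.
move=> [[jm jj] jfree]; split=> [jinj x y z|distr x y jxy].
  by apply: jinj; rewrite jm !jj !jm; exact: vl_distributive.
apply: contrapT => nxy.
have [phi [hphi]] := distributive_separation R distr nxy.
by have [psi [[_ ->] _]] := jfree (scalars R) phi hphi; rewrite /= jxy.
Qed.

End CanonicalMaps.

Theorem theorem7p1 (R : realType) (d : Order.disp_t) (L : latticeType d)
    (L_nonempty : inhabited L) :
  [/\ exists (F : vectorLatticeType R) (j : L -> F), is_free_VL j,
      exists (F : vlaType R) (j : L -> F), is_free_VLA j,
      exists (F : unitalVlaType R) (j : L -> F), is_free_VLA1 j
    & exists (F : posUnitalVlaType R) (j : L -> F), is_free_VLA1p j]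
  /\
  (forall (F0 : vectorLatticeType R) (j0 : L -> F0)
          (F1 : vlaType R) (j1 : L -> F1)
          (F2 : unitalVlaType R) (j2 : L -> F2)
          (F3 : posUnitalVlaType R) (j3 : L -> F3),
     is_free_VL j0 -> is_free_VLA j1 -> is_free_VLA1 j2 -> is_free_VLA1p j3 ->
     [/\ exists psi : F0 -> F1,
           is_canonical_map (@vl_hom R F0 F1) j0 j1 psi /\ injective psi,
         exists psi : F1 -> F2,
           is_canonical_map (@vla_hom R F1 F2) j1 j2 psi /\ injective psi,
         exists psi : F1 -> F3,
           is_canonical_map (@vla_hom R F1 F3) j1 j3 psi /\ injective psi,
         exists psi : F2 -> F3,
           is_canonical_map (@vla1_hom R F2 F3) j2 j3 psi /\ surjective psi
       & injective j0 <-> distributive_lattice L]).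
Proof.
split.
  split.
  - by exists (free_vector_lattice R L), (@free_gen _ _ _ _ _ _ _);
      exact: free_vector_lattice_free.
  - by exists (@free_algebra R d L (vlaType R) id (fun=> 0)),
      (@free_gen _ _ _ _ _ _ _);
      exact: free_algebra_free.
  - by exists (@free_unital_algebra R d L (unitalVlaType R) id),
      (@free_gen _ _ _ _ _ _ _);
      exact: free_unital_algebra_free.
  - by exists (@free_pos_unital_algebra R d L (posUnitalVlaType R) id),
      (@free_gen _ _ _ _ _ _ _); exact: free_pos_unital_algebra_free.
move=> F0 j0 F1 j1 F2 j2 F3 j3 free0 free1 free2 free3.
have [hom0 univ0] := free0; have [hom1 univ1] := free1.
have [hom2 univ2] := free2; have [hom3 univ3] := free3.
have in_hom :
    lat_hom (@unitization_in R F1 \o j1 : L -> vl_lattice (unitization F1)).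
  exact: lat_hom_comp hom1 (unitization_in_hom F1).1.
split.
- have [psi psiP] := univ0 F1 j1 hom1; exists psi; split=> //.
  have [[hpsi jE] _] := psiP.
  exact: free_VL_VLA_injective free0 free1 hpsi jE.
- have [psi psiP] := univ1 F2 j2 hom2; exists psi; split=> //.
  have [[hpsi jE] _] := psiP.
  apply: (free_VLA_unital_injective free1 hpsi jE).
  have [theta [[[htheta _] tE] _]] := univ2 (unitization F1) _ in_hom.
  by exists theta.
- have [psi psiP] := univ1 F3 j3 hom3; exists psi; split=> //.
  have [[hpsi jE] _] := psiP.
  apply: (free_VLA_unital_injective free1 hpsi jE).
  have [theta [[[htheta _] tE] _]] := univ3 (unitization F1) _ in_hom.
  by exists theta.
- have [psi psiP] := univ2 F3 j3 hom3; exists psi; split=> //.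
  have [[hpsi jE] _] := psiP.
  exact: free_VLA1_VLA1p_surjective free3 hpsi jE.
- exact: free_VL_injectiveP free0.
Qed.
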